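(* Let $X$ be a spectral space. Then there exists an (additively) idempotent semiring $A$ such that the prime $k$-spectrum $\mathrm{Spec}_k A$ of $A$ is homeomorphic to $X$.
   Context: A semiring is a nonempty set $A$ with operations $+,\cdot$ such that $(A,+)$ and $(A,\cdot)$ are commutative monoids (with identities $0$ and $1$), $(a+b)c=ac+bc$ and $0\cdot a=0$ for all $a,b,c\in A$. It is idempotent if $a+a=a$ for all $a$. An ideal of $A$ is an additive submonoid $I$ with $AI\subseteq I$; it is a $k$-ideal if $x\in I$ and $x+y\in I$ imply $y\in I$. For $k$-ideals $I,J$, the product $IJ$ is the smallest $k$-ideal containing $\{xy\mid x\in I,y\in J\}$. A prime $k$-ideal is a proper $k$-ideal $\mathfrak p$ such that for all $k$-ideals $I,J$, $IJ\subseteq\mathfrak p$ implies $I\subseteq\mathfrak p$ or $J\subseteq\mathfrak p$. For a set $S$, the hull-kernel topology on the power set $2^S$ has as open sub-basis the sets $D(F)=\{I\in 2^S\mid F\not\subseteq I\}$, $F$ a finite subset of $S$. The prime $k$-spectrum $\mathrm{Spec}_k A$ is the set of all prime $k$-ideals of $A$ with the subspace topology induced from the hull-kernel topology on $2^A$. A spectral space is a quasi-compact $T_0$ topological space in which finite intersections of quasi-compact open subsets are quasi-compact open, the quasi-compact open subsets form a basis, and every nonempty irreducible closed subset has a unique generic point. *)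

(* Defs.v *)
From HB Require Import structures.
From mathcomp Require Import all_boot all_order all_algebra.
From mathcomp Require Import all_classical all_analysis.

Set Implicit Arguments.
Unset Strict Implicit.
Unset Printing Implicit Defensive.

Import GRing.Theory.

Local Open Scope classical_set_scope.
Local Open Scope ring_scope.

Definition homeomorphic (X Y : topologicalType) : Prop :=
  exists (f : X -> Y) (g : Y -> X),
    [/\ cancel f g, cancel g f, continuous f & continuous g].

Section Spectral.
Variable X : topologicalType.

(* The library's [compact] assumes no separation axiom. *)
Definition qcopen (U : set X) : Prop := open U /\ compact U.

Definition irreducible_set (Z : set X) : Prop :=
  Z !=set0 /\
  forall Z1 Z2 : set X, closed Z1 -> closed Z2 ->
    Z `<=` Z1 `|` Z2 -> Z `<=` Z1 \/ Z `<=` Z2.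

Record spectral_space : Prop := SpectralSpace {
  spectral_compact : compact [set: X];
  spectral_T0 : kolmogorov_space X;
  spectral_bigcap : forall F : set (set X),
    finite_set F -> F `<=` qcopen -> qcopen (\bigcap_(U in F) U);
  spectral_basis : basis qcopen;
  spectral_sober : forall Z : set X, closed Z -> irreducible_set Z ->
    exists! x : X, closure [set x] = Z
}.

End Spectral.

(* The power set of S under a fresh name, since [set S] = S -> Prop may
   otherwise be seen as a function space. *)
Definition hull_kernel (S : Type) : Type := set S.

Section HullKernel.
Variable S : Type.

Definition hk_subbasic (F : set S) : set (hull_kernel S) :=
  [set I : hull_kernel S | ~ (F `<=` I)].

HB.instance Definition _ := Choice.copy (hull_kernel S) (set S).
HB.instance Definition _ := @isSubBaseTopological.Build (hull_kernel S)
  (set S) (@finite_set S) hk_subbasic.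

End HullKernel.

(* [comPzSemiRingType] does not require 0 != 1, so the one-element semiring is
   allowed. *)
Section KIdeals.
Variable A : comPzSemiRingType.
Implicit Types I J P : set A.

Definition ideal I : Prop :=
  [/\ I 0, forall x y, I x -> I y -> I (x + y) & forall a x, I x -> I (a * x)].

Definition kideal I : Prop :=
  ideal I /\ forall x y, I x -> I (x + y) -> I y.

Definition kideal_mul I J : set A :=
  smallest kideal [set x * y | x in I & y in J].

Definition prime_kideal P : Prop :=
  [/\ kideal P, P <> [set: A] &
    forall I J, kideal I -> kideal J ->
      kideal_mul I J `<=` P -> I `<=` P \/ J `<=` P].

(* The library gives the type of elements of a set the subspace topology. *)
Definition Spec_k : topologicalType :=
  set_type [set P : hull_kernel A | prime_kideal P].

End KIdeals.

Definition idempotent_semiring (A : comPzSemiRingType) : Prop :=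
  forall a : A, a + a = a.

(* Main.v *)
(** Stone duality: for a spectral space [X] take the distributive lattice of
    quasi-compact open sets, with union as sum and intersection as product.
    Its k-ideals are the lattice ideals.  A point [x] gives the prime ideal of
    the quasi-compact open sets missing [x]; conversely the complement of the
    union of a prime ideal is irreducible and closed, and its generic point
    recovers the ideal because a quasi-compact open set covered by an ideal,
    which is directed, lies in it. *)
Require Import Defs.
From HB Require Import structures.
From mathcomp Require Import all_boot all_order all_algebra.
From mathcomp Require Import all_classical all_analysis.

Set Implicit Arguments.
Unset Strict Implicit.
Unset Printing Implicit Defensive.

Import GRing.Theory.

Local Open Scope classical_set_scope.
Local Open Scope ring_scope.

(* [compact_cover] would need a pointed space. *)
Lemma compact_directed_cover (T : topologicalType) (I : Type) (K : set T)
    (D : set I) (f : I -> set T) :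
  compact K -> D !=set0 -> (forall i, D i -> open (f i)) ->
  (forall i j, D i -> D j ->
     exists2 k, D k & f i `|` f j `<=` f k) ->
  K `<=` \bigcup_(i in D) f i ->
  exists2 i, D i & K `<=` f i.
Proof.
move=> cK D0 fop fdir Kf; apply: contrapT => nK.
(* If no [f i] covers [K], the differences of [K] and the [f i] form a proper filter base by
   directedness. A cluster point in [K] lies in some open [f i], a neighbourhood that cannot meet
   [K] minus [f i]. *)
have FF : ProperFilter (filter_from D (fun i => K `\` f i)).
  apply: filter_from_proper; first apply: filter_from_filter => //.
  - move=> i j Di Dj; have [k Dk fk] := fdir i j Di Dj.
    exists k => // x [Kx fkx].
    by split; split=> // fx; apply: fkx; apply: fk; [left|right].
  - move=> i Di; apply: contrapT => KD0; apply: nK; exists i => // x Kx.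
    by apply: contrapT => fx; apply: KD0; exists x.
have [|x [Kx clx]] := cK _ FF.
  by have [i Di] := D0; exists i => // x [].
have [i Di fix_] := Kf x Kx.
have nfi : nbhs x (f i) by apply: open_nbhs_nbhs; split=> //; exact: fop.
have [|y [[_ nfy] fy]] := clx (K `\` f i) (f i) _ nfi.
  by exists i.
exact: nfy.
Qed.

(** * Continuity into the hull-kernel topology *)

Section HullKernelTopology.
Variable S : Type.

Lemma hk_subbasic_open (F : set S) : finite_set F -> open (hk_subbasic F).
Proof.
move=> fF; exists [set hk_subbasic F]; last by rewrite bigcup_set1.
by move=> _ ->; apply: finI_from1.
Qed.

(** Singletons suffice: a finite [F] fails to lie in [I] exactly when some [a] in [F] is outside
    [I], so its subbasic set is the union of those of its points. *)
Lemma continuous_hull_kernel (T : topologicalType) (g : T -> hull_kernel S) :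
  (forall a, open [set t | ~ g t a]) -> continuous g.
Proof.
move=> gop; apply/continuousP => _ [B sB <-].
rewrite preimage_bigcup; apply: bigcup_open => _ /sB[G sG <-].
rewrite preimage_bigcap openE => t Gt; apply: filter_bigI => F FG.
apply: open_nbhs_nbhs; split; last exact: Gt.
rewrite (_ : _ @^-1` _ = \bigcup_(a in F) [set t | ~ g t a]).
  exact: bigcup_open.
apply/seteqP; split=> s /=.
  move=> nF; apply: contrapT => H; apply: nF => a Fa.
  by apply: contrapT => ga; apply: H; exists a.
by case=> a Fa nga sF; apply: nga; apply: sF.
Qed.

End HullKernelTopology.

Section KIdealTheory.
Variable A : comPzSemiRingType.

Lemma kideal0 (P : set A) : kideal P -> P 0.
Proof. by case=> -[]. Qed.

Lemma prime_kideal_proper (P : set A) : prime_kideal P -> ~ P 1.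
Proof.
case=> [[[_ _ PM] _] nT _] P1; apply: nT; apply/seteqP; split=> // a _.
by rewrite -(mulr1 a); apply: PM.
Qed.

End KIdealTheory.

(** * Quasi-compact open sets of a spectral space *)

Section QuasiCompactOpens.
Variable X : topologicalType.
Hypothesis hX : spectral_space X.

Lemma qcopen0 : qcopen (@set0 X).
Proof. by split; [exact: open0 | exact: compact0]. Qed.

Lemma qcopenT : qcopen [set: X].
Proof. by split; [exact: openT | exact: spectral_compact hX]. Qed.

Lemma qcopenU (U V : set X) : qcopen U -> qcopen V -> qcopen (U `|` V).
Proof. by move=> [? ?] [? ?]; split; [exact: openU | exact: compactU]. Qed.

Lemma qcopenI (U V : set X) : qcopen U -> qcopen V -> qcopen (U `&` V).
Proof.
move=> qU qV; have := spectral_bigcap hX (finite_set2 U V).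
rewrite bigcap_setU !bigcap_set1; apply.
by move=> W [->|->].
Qed.

Lemma qcopen_nbhs (x : X) (W : set X) : nbhs x W ->
  exists U, [/\ qcopen U, U x & U `<=` W].
Proof. by move=> /(spectral_basis hX).2[U [qU Ux] UW]; exists U. Qed.

Lemma qcopen_separated (x y : X) :
  (forall U, qcopen U -> (U x <-> U y)) -> x = y.
Proof.
move=> xy; apply/eqP; apply/negPn/negP => /(spectral_T0 hX)[W].
by case=> -[]; rewrite !inE => /qcopen_nbhs[U [qU Ux UW]]; apply; apply: UW;
  exact/(xy U qU).
Qed.

End QuasiCompactOpens.

(** The spectrality proof is a parameter of the type so that the semiring instance, whose unit and
    product depend on it, can be inferred from the type alone. *)
Definition qcopens (X : topologicalType) (_ : spectral_space X) : Type :=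
  set_type (@qcopen X).

Section QuasiCompactOpensSemiring.
Variables (X : topologicalType) (hX : spectral_space X).
Local Notation L := (qcopens hX).

HB.instance Definition _ := Choice.on L.

Definition qcval (u : L) : set X := set_val u.

Lemma qcvalP (u : L) : qcopen (qcval u).
Proof. exact: (set_valP u). Qed.

Definition Qcopen (U : set X) (qU : qcopen U) : L := SigSub (mem_set qU).

Lemma qcval_inj : injective qcval.
Proof. exact: val_inj. Qed.

Definition qc0 : L := Qcopen (@qcopen0 X).
Definition qc1 : L := Qcopen (qcopenT hX).
Definition qcadd (u v : L) : L := Qcopen (qcopenU (qcvalP u) (qcvalP v)).
Definition qcmul (u v : L) : L := Qcopen (qcopenI hX (qcvalP u) (qcvalP v)).

Fact qcaddA : associative qcadd.
Proof. by move=> u v w; apply: qcval_inj; apply: setUA. Qed.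
Fact qcaddC : commutative qcadd.
Proof. by move=> u v; apply: qcval_inj; apply: setUC. Qed.
Fact qcadd0 : left_id qc0 qcadd.
Proof. by move=> u; apply: qcval_inj; apply: set0U. Qed.

HB.instance Definition _ := GRing.isNmodule.Build L qcaddA qcaddC qcadd0.

Fact qcmulA : associative qcmul.
Proof. by move=> u v w; apply: qcval_inj; apply: setIA. Qed.
Fact qcmulC : commutative qcmul.
Proof. by move=> u v; apply: qcval_inj; apply: setIC. Qed.
Fact qcmul1 : left_id qc1 qcmul.
Proof. by move=> u; apply: qcval_inj; apply: setTI. Qed.
Fact qcmulDl : left_distributive qcmul qcadd.
Proof. by move=> u v w; apply: qcval_inj; apply: setIUl. Qed.
Fact qcmul0 : left_zero qc0 qcmul.
Proof. by move=> u; apply: qcval_inj; apply: set0I. Qed.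

HB.instance Definition _ := GRing.Nmodule_isComPzSemiRing.Build L
  qcmulA qcmulC qcmul1 qcmulDl qcmul0.

Lemma qcvalD (u v : L) : qcval (u + v) = qcval u `|` qcval v.
Proof. by []. Qed.

Lemma qcvalM (u v : L) : qcval (u * v) = qcval u `&` qcval v.
Proof. by []. Qed.

Lemma qcopens_idempotent : idempotent_semiring L.
Proof. by move=> u; apply: qcval_inj; rewrite qcvalD setUid. Qed.

(** * Ideals of the lattice of quasi-compact open sets *)

Lemma kideal_downward (I : set L) (u v : L) :
  kideal I -> I v -> qcval u `<=` qcval v -> I u.
Proof.
move=> [[_ _ IM] _] Iv uv; suff -> : u = u * v by exact: IM.
by apply: qcval_inj; rewrite qcvalM; apply/esym/setIidPl.
Qed.

(** [0] makes the family nonempty and sums make it directed, so compactness puts [u] below a single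
    member of [I]. *)
Lemma kideal_bigcup (I : set L) (u : L) :
  kideal I -> qcval u `<=` \bigcup_(v in I) qcval v -> I u.
Proof.
move=> kI uI.
have [v Iv uv] : exists2 v, I v & qcval u `<=` qcval v.
  apply: compact_directed_cover uI.
  - by have [] := qcvalP u.
  - by exists 0; exact: kideal0.
  - by move=> v _; have [] := qcvalP v.
  - move=> v w Iv Iw; exists (v + w); last by rewrite qcvalD.
    by have [[_ + _] _] := kI; apply.
exact: kideal_downward uv.
Qed.

Lemma principal_kideal (w : L) : kideal [set u | qcval u `<=` qcval w].
Proof.
split; first split=> /=.
- by move=> x [].
- by move=> u v uw vw; rewrite qcvalD subUset.
- by move=> a u uw x; rewrite qcvalM => -[_ /uw].
- by move=> u v /= _; rewrite qcvalD => uvw x vx; apply: uvw; right.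
Qed.

(** Primality over ideals is tested on the principal ideals of [u] and [v]: products of their
    elements lie below [u * v], hence in [P]. *)
Lemma prime_kidealM (P : set L) (u v : L) :
  prime_kideal P -> P (u * v) -> P u \/ P v.
Proof.
move=> [kP _ primeP] Puv.
have [|uP|vP] := primeP _ _ (principal_kideal u) (principal_kideal v).
- apply: smallest_sub => // _ [a /= au] [b /= bv <-].
  by apply: kideal_downward Puv _ => //; rewrite !qcvalM; apply: setISS.
- by left; apply: uP.
- by right; apply: vP.
Qed.

Lemma prime_kideal_generic (P : set L) : prime_kideal P ->
  exists x, forall u, P u <-> ~ qcval u x.
Proof.
move=> pP; have [kP _ _] := pP.
pose Z := ~` \bigcup_(u in P) qcval u.
have clZ : closed Z.
  apply: open_closedC; apply: bigcup_open => u _.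
  by have [] := qcvalP u.
(* A basic neighbourhood of [x] missing [Y] cannot belong to [P], since it meets [Z] at [x]. *)
have sep x (Y : set X) : closed Y -> Z x -> ~ Y x ->
    exists u, [/\ ~ P u, qcval u x & qcval u `<=` ~` Y].
  move=> clY Zx nYx.
  have [|U [qU Ux UY]] := @qcopen_nbhs X hX x (~` Y).
    by apply: open_nbhs_nbhs; split=> //; exact: closed_openC.
  exists (Qcopen qU); split=> // PU; apply: Zx.
  by exists (Qcopen qU).
have irrZ : irreducible_set Z.
  split.
    (* Were [Z] empty, [P] would cover the whole space and so contain [1]. *)
    apply/set0P/negP => /eqP Z0; apply: (prime_kideal_proper pP).
    apply: kideal_bigcup => // x _; apply: contrapT => nx.
    by suff: set0 x by []; rewrite -Z0.
  move=> Z1 Z2 cl1 cl2 Z12; apply: contrapT => /not_orP[n1 n2].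
  have [x Zx nx] : exists2 x, Z x & ~ Z1 x.
    apply: contrapT => H; apply: n1 => x Zx.
    by apply: contrapT => nx; apply: H; exists x.
  have [y Zy ny] : exists2 y, Z y & ~ Z2 y.
    apply: contrapT => H; apply: n2 => y Zy.
    by apply: contrapT => ny; apply: H; exists y.
  have [u [nu _ u1]] := sep _ _ cl1 Zx nx.
  have [v [nv _ v2]] := sep _ _ cl2 Zy ny.
  (* The intersection of [u] and [v] misses both [Z1] and [Z2], hence [Z], so members of [P] cover
     it. *)
  suff /(prime_kidealM pP)[] : P (u * v) by [].
  apply: kideal_bigcup => // z; rewrite qcvalM => -[uz vz].
  apply: contrapT => Zz; case: (Z12 z Zz) => [/(u1 z uz)|/(v2 z vz)]; exact.
have [x [clx _]] := spectral_sober hX clZ irrZ.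
exists x => u; split=> [Pu ux|nux].
  have: Z x by rewrite -clx; apply: subset_closure.
  by apply; exists u.
(* An open set missing the generic point [x] misses its closure [Z], so [u] is covered by members of
   [P]. *)
apply: kideal_bigcup => // y uy; apply: contrapT => Zy.
have: closure [set x] y by rewrite clx.
have [ou _] := qcvalP u.
move=> /(_ _ (open_nbhs_nbhs (conj ou uy)))[_ [->]].
exact: nux.
Qed.

(** * The prime ideal of a point, and the homeomorphism *)

Definition point_kideal (x : X) : set L := [set u | ~ qcval u x].

Lemma point_kideal_prime (x : X) : prime_kideal (point_kideal x).
Proof.
split.
- split; first split.
  + by case.
  + by move=> u v nu nv; rewrite /point_kideal /= qcvalD => -[].
  + by move=> a u nu; rewrite /point_kideal /= qcvalM => -[_].
  + move=> u v _; rewrite /point_kideal /= qcvalD => nuv vx.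
    by apply: nuv; right.
- move=> E; have : point_kideal x 1 by rewrite E.
  by apply.
move=> I J kI kJ IJx; apply: contrapT => /not_orP[nI nJ].
apply: nI => u Iu ux; apply: nJ => v Jv vx.
suff: point_kideal x (u * v) by apply.
by apply: IJx => K [_]; apply; exists u => //; exists v.
Qed.

Lemma Spec_k_homeomorphic : homeomorphic (Spec_k L) X.
Proof.
have /choice[f fP] : forall P : Spec_k L,
    exists x, forall u, (set_val P : set L) u <-> ~ qcval u x.
  by move=> P; apply: prime_kideal_generic; exact: (set_valP P).
pose g (x : X) : Spec_k L := SigSub (mem_set (point_kideal_prime x)).
exists f, g; split.
- move=> P; apply: val_inj; apply/seteqP; split=> u.
    exact: (fP P u).2.
  exact: (fP P u).1.
(* [f (g x)] and [x] lie in the same quasi-compact open sets, so they agree by the T0 axiom. *)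
- move=> x; apply: (qcopen_separated hX) => U qU.
  have := fP (g x) (Qcopen qU); rewrite /= => E.
  have {}E : ~ U x <-> ~ U (f (g x)) := E.
  by apply/iff_not2; apply: iff_sym.
(* The preimage under [f] of a basic open [U] is the subbasic open set of the singleton of [U]. *)
- move=> P W /(qcopen_nbhs hX)[U [qU UfP UW]].
  have Vop : open (set_val @^-1` hk_subbasic [set Qcopen qU] : set (Spec_k L)).
    by exists (hk_subbasic [set Qcopen qU]) => //; exact: hk_subbasic_open.
  have fU (Q : Spec_k L) : hk_subbasic [set Qcopen qU] (set_val Q) <-> U (f Q).
    rewrite /hk_subbasic /= sub1set; split=> [nQ|UQ].
      by apply: contrapT => nU; apply: nQ; rewrite inE; apply/fP.
    by rewrite inE => /fP.
  apply: filterS (open_nbhs_nbhs (conj Vop _)); last exact/fU.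
  by move=> Q /fU/UW.
(* Conversely, the preimage under [g] of the subbasic set of [u] alone is the open set [u]
   itself. *)
- apply: continuous_comp_initial; apply: continuous_hull_kernel => u.
  rewrite (_ : [set _ | _] = qcval u); first by have [] := qcvalP u.
  by apply/seteqP; split=> x /=; [move=> /contrapT | move=> ux; apply].
Qed.

End QuasiCompactOpensSemiring.

Theorem theoremA (X : topologicalType) (hX : spectral_space X) :
  exists A : comPzSemiRingType,
    idempotent_semiring A /\ homeomorphic (Spec_k A) X.
Proof.
exists (qcopens hX); split; first exact: qcopens_idempotent.
exact: Spec_k_homeomorphic.
Qed.
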